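(* Let $v_i,w_i\in\mathbb{R}^2$ be unit vectors and $\lambda_i\in(0,1)$, $i=1,2,3,4$. Suppose that the vectors $v_1,v_2,v_3,v_4$ are disposed in this order as one moves around the unit circle in the clockwise direction, while the vectors $w_1,w_2,w_3,w_4$ appear in this order in the counterclockwise direction. In addition, assume that $\sum_{i=1}^4\lambda_i=1$ and $\sum_{i=1}^4\lambda_iv_i=0=\sum_{i=1}^4\lambda_iw_i$. Then there exists a choice of three indices $A\subset\{1,2,3,4\}$, $\#A=3$, such that the origin of $\mathbb{R}^2$ belongs both to the triangle with vertices at the points of $\{v_i:i\in A\}$ and to the triangle with vertices at the points of $\{w_i:i\in A\}$.
   Context: A triangle with given vertices means the closed convex hull of these points. *)

(* Defs.v *)
From HB Require Import structures.
From mathcomp Require Import all_boot all_order all_algebra.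
From mathcomp Require Import all_classical all_reals all_analysis.
Import Order.TTheory GRing.Theory Num.Theory.
Import numFieldNormedType.Exports.

Set Implicit Arguments.
Unset Strict Implicit.
Unset Printing Implicit Defensive.

Local Open Scope classical_set_scope.
Local Open Scope ring_scope.

(* The library norm on ['rV[R]_2] is the sup norm, hence the explicit
   Euclidean condition. *)
Definition unit_vector (R : realType) (u : 'rV[R]_2) : Prop :=
  u 0 0 ^+ 2 + u 0 1 ^+ 2 = 1.

Definition circle_point (R : realType) (t : R) : 'rV[R]_2 :=
  \row_(j < 2) (if j == 0 then cos t else sin t).

(* Going once around the unit circle counterclockwise, by at most one full
   turn, meets [u 0], [u 1], [u 2], [u 3] in this order.  Coinciding vectors
   are allowed, since they are not required to be distinct. *)
Definition counterclockwise_order (R : realType) (u : 'I_4 -> 'rV[R]_2) : Prop :=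
  exists t : 'I_4 -> R,
    [/\ forall i, u i = circle_point (t i),
        forall i j : 'I_4, (i <= j)%N -> t i <= t j
      & t ord_max <= t ord0 + pi *+ 2].

Definition clockwise_order (R : realType) (u : 'I_4 -> 'rV[R]_2) : Prop :=
  exists t : 'I_4 -> R,
    [/\ forall i, u i = circle_point (t i),
        forall i j : 'I_4, (i <= j)%N -> t j <= t i
      & t ord0 - pi *+ 2 <= t ord_max].

Definition closed_convex_hull (R : realType) (X : set 'rV[R]_2) : set 'rV[R]_2 :=
  smallest [set C : set 'rV[R]_2 | @convex_set R 'rV[R]_2 C /\ closed C] X.

(* Main.v *)
Require Import Defs.
From mathcomp Require Import all_boot all_order all_algebra.
From mathcomp Require Import all_classical all_reals all_analysis.
From mathcomp Require Import ring lra.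
Import Order.TTheory GRing.Theory Num.Theory.
Import numFieldNormedType.Exports.
Local Open Scope classical_set_scope.
Local Open Scope ring_scope.

(** Call an index [m] removable for [u] when the origin lies in the triangle
    spanned by the three vectors other than [u m], and essential otherwise.
    The theorem asks for an index that is removable for both [v] and [w].

    Orientation gives removable indices in opposite pairs.  If the directions
    [u i], [u j], [u k], [u l] follow each other around the circle, then going
    from [u i] to [u k] through [u j] or through [u l] takes at most half a
    turn.  The vector in between is a nonnegative combination of [u i] and
    [u k], and substituting it into the relation [\sum_m lambda m *: u m = 0]
    shows that its index is removable ([opposite_triangles]).  So each of [v]
    and [w] has a removable index among 0, 2 and another one among 1, 3; a
    clockwise order is a counterclockwise one read backwards.

    Suppose that no index is removable for both.  Then [v] has exactly two
    removable indices [i], [j], and those of [w] are exactly the other two,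
    [k] and [l].  The contradiction comes from the weights, which [v] and [w]
    share: the two essential indices always carry more than the two removable
    ones ([essential_pair_heavier]), so [lambda i + lambda j] would be both
    smaller and larger than [lambda k + lambda l].

    The comparison of weights is the triangle inequality.  As [i] and [j] are
    removable, [- u j] and [- u i] are nonnegative combinations of [u k] and
    [u l], with coefficients of sum larger than 1 because all the vectors are
    unit vectors ([essential_weight_lt]).  Since [u k] and [u l] are linearly
    independent ([essential_independent]), comparing coefficients in
    [lambda k *: u k + lambda l *: u l = lambda i *: - u i + lambda j *: - u j]
    and summing gives the claim.

    In terms of plane geometry, the vectors [lambda m *: u m] are the sides of
    a convex quadrilateral.  When [k] and [l] are essential, the vertex between
    the sides [i] and [j] is inside the parallelogram spanned by the sides [k]
    and [l], so that the path along [i] and [j] is the shorter one. *)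

(** * Convex combinations and triangles *)

(** A triangle is named by the index that it leaves out, since the argument
    compares four triangles that each omit one of four vectors. *)
Definition origin_in_triangle_off {R : realType} (u : 'I_4 -> 'rV[R]_2) (m : 'I_4) :=
  exists mu : 'I_4 -> R, [/\ forall i, 0 <= mu i, mu m = 0,
    \sum_i mu i = 1 & \sum_i mu i *: u i = 0].

Lemma convex_set_comb {R : realType} {V : lmodType R} (C : set V) :
  convex_set C -> forall (x y : V) (a b : R),
  C x -> C y -> 0 <= a -> 0 <= b -> 0 < a + b ->
  C ((a + b)^-1 *: (a *: x + b *: y)).
Proof.
move=> Cc x y a b Cx Cy a0 b0 ab0.
have t01 : Itv.spec (@Itv.num_sem R) (Itv.Real `[0%Z, 1%Z]) (a / (a + b)).
  rewrite /Itv.spec /Itv.num_sem /= num_real/= in_itv /=.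
  by rewrite (divr_ge0 a0 (ltW ab0)) /= ler_pdivrMr// mul1r lerDl.
have := Cc x y (Itv.mk t01) (mem_set Cx) (mem_set Cy).
rewrite inE; congr (C _).
rewrite /conv /= scalerDr !scalerA mulrC; congr (_ + _ *: _).
by rewrite /unstable.onem; field; rewrite lt0r_neq0.
Qed.

(** Stated for unnormalized weights, so that the induction on [r] does not have
    to rescale the tail. *)
Lemma convex_set_sum {R : realType} {V : lmodType R} (C : set V)
    (I : Type) (r : seq I) (mu : I -> R) (u : I -> V) :
  convex_set C -> (forall i, 0 <= mu i) -> (forall i, 0 < mu i -> C (u i)) ->
  0 < \sum_(i <- r) mu i ->
  C ((\sum_(i <- r) mu i)^-1 *: \sum_(i <- r) mu i *: u i).
Proof.
move=> Cc mu0 Cu; elim: r => [|i r IHr]; first by rewrite big_nil ltxx.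
rewrite !big_cons.
have := mu0 i; rewrite le_eqVlt => /predU1P[<-|mui]; first by rewrite scale0r !add0r.
(* A tail of total weight zero has no weighted mean: all its terms vanish. *)
have : 0 <= \sum_(j <- r) mu j by apply: sumr_ge0.
rewrite le_eqVlt => /predU1P[/esym r0 _|r0 s0]; last first.
  have := convex_set_comb C Cc _ _ _ _ (Cu i mui) (IHr r0) (ltW mui) (ltW r0) s0.
  by rewrite [in X in C X -> _]scalerA divff ?lt0r_neq0// scale1r.
rewrite (_ : \sum_(j <- r) mu j *: u j = 0) ?r0.
  by rewrite !addr0 scalerA mulVf ?lt0r_neq0// scale1r; exact: Cu.
elim: r r0 {IHr} => [|j r IHr]; first by rewrite !big_nil.
rewrite !big_cons => /eqP; rewrite paddr_eq0 ?sumr_ge0// => /andP[/eqP-> /eqP/IHr->].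
by rewrite scale0r addr0.
Qed.

Lemma origin_in_hull {R : realType} (u : 'I_4 -> 'rV[R]_2) (m : 'I_4) :
  origin_in_triangle_off u m ->
  closed_convex_hull [set u i | i in [set` [set~ m]%SET]] 0.
Proof.
move=> [mu [mu0 mum mu1 mu_u]] C [[Cc _] uC].
rewrite -[0](scaler0 _ (\sum_i mu i)^-1) -mu_u.
apply: convex_set_sum => //; last by rewrite mu1.
move=> i mui; apply: uC; exists i => //=.
by rewrite !inE; apply: contraTneq mui => ->; rewrite mum ltxx.
Qed.

Lemma uniq_to_front2 {T : eqType} {i j k l : T} :
  uniq [:: i; j; k; l] -> uniq [:: j; i; k; l].
Proof. by rewrite (perm_uniq (permEl (perm_catCA [:: i] [:: j] [:: k; l]))). Qed.

Lemma uniq_to_front3 {T : eqType} {i j k l : T} :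
  uniq [:: i; j; k; l] -> uniq [:: k; i; j; l].
Proof. by rewrite (perm_uniq (permEl (perm_catCA [:: i; j] [:: k] [:: l]))). Qed.

Lemma uniq_to_front4 {T : eqType} {i j k l : T} :
  uniq [:: i; j; k; l] -> uniq [:: l; i; j; k].
Proof. by rewrite (perm_uniq (permEl (perm_catC [:: i; j; k] [:: l]))). Qed.

Lemma uniq_rot2 {T : eqType} {i j k l : T} :
  uniq [:: i; j; k; l] -> uniq [:: k; l; i; j].
Proof. by rewrite (perm_uniq (permEl (perm_catC [:: i; j] [:: k; l]))). Qed.

Lemma sum_four {V : nmodType} {i j k l : 'I_4} (F : 'I_4 -> V) :
  uniq [:: i; j; k; l] -> \sum_m F m = F i + F j + F k + F l.
Proof.
move=> uq; transitivity (\sum_(m <- [:: i; j; k; l]) F m).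
  rewrite [RHS]big_uniq//=; apply: eq_bigl => m.
  have c4 : #|[:: i; j; k; l]| = #|'I_4| by rewrite card_ord (card_uniqP uq).
  by rewrite (subset_cardP c4 (subset_predT _)).
by rewrite !big_cons big_nil addr0 !addrA.
Qed.

Lemma rV2P {R : realType} (u : 'rV[R]_2) : u = 0 <-> u 0 0 = 0 /\ u 0 1 = 0.
Proof.
split=> [->|[u0 u1]]; first by rewrite !mxE.
apply/rowP => j; rewrite !mxE; case: j => [[|[|//]] jlt].
  by rewrite -[RHS]u0; congr (u _ _); exact: val_inj.
by rewrite -[RHS]u1; congr (u _ _); exact: val_inj.
Qed.

(** The weights need not be normalized: this is the form in which relations
    between three of the vectors arise below. *)
Lemma origin_in_triangle_offP {R : realType} (u : 'I_4 -> 'rV[R]_2)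
    {i j k l : 'I_4} : uniq [:: i; j; k; l] ->
  origin_in_triangle_off u i <->
  exists b c d : R, [/\ [/\ 0 <= b, 0 <= c & 0 <= d], 0 < b + c + d
    & b *: u j + c *: u k + d *: u l = 0].
Proof.
move=> uq; split=> [[mu [mu0 mui]]|[b [c [d [[b0 c0 d0] s0 e]]]]].
  rewrite !(sum_four _ uq) mui scale0r !add0r => mu1 mu_u.
  by exists (mu j), (mu k), (mu l); split => //; rewrite mu1.
pose s := b + c + d.
exists (fun m => (if m == j then b else if m == k then c else
  if m == l then d else 0) / s).
move: (uq); rewrite /= !inE !negb_or => /and4P[/and3P[ij ik il] /andP[jk jl] kl _].
have [ji ki li] : [/\ j == i = false, k == i = false & l == i = false].
  by split; apply/negbTE; rewrite eq_sym.
split.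
- move=> m; apply: divr_ge0 (ltW s0); by do 3?case: ifP.
- by rewrite (negbTE ij) (negbTE ik) (negbTE il) mul0r.
- rewrite (sum_four _ uq) (negbTE ij) (negbTE ik) (negbTE il) !eqxx.
  rewrite [k == j]eq_sym (negbTE jk) [l == j]eq_sym (negbTE jl).
  rewrite [l == k]eq_sym (negbTE kl) mul0r add0r -!mulrDl divff//.
  by rewrite lt0r_neq0.
- rewrite (sum_four _ uq) (negbTE ij) (negbTE ik) (negbTE il) !eqxx.
  rewrite [k == j]eq_sym (negbTE jk) [l == j]eq_sym (negbTE jl).
  rewrite [l == k]eq_sym (negbTE kl) mul0r scale0r add0r.
  by rewrite ![_ / s]mulrC -!scalerA -!scalerDr e scaler0.
Qed.

(** * Removable indices from the circular order *)

(** Up to the factors, which are nonnegative when [a <= b <= c <= a + pi], this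
    places the middle direction in the cone of the outer two. *)
Lemma sin_arc {R : realType} (a b c : R) :
  sin (c - a) *: circle_point b =
  sin (c - b) *: circle_point a + sin (b - a) *: circle_point c.
Proof.
apply/rowP => j; rewrite !mxE !sinB.
by case: ifP => _; ring.
Qed.

(** Replacing [u j] by its expression from [sin_arc] in the relation between
    the four vectors keeps the weights nonnegative.  The factor [sin (c - a)]
    in front of [u j] vanishes only when [u i] and [u k] are equal (then so is
    [u j]) or antipodal, where the origin is already on their segment. *)
Lemma arc_le_pi {R : realType} (u : 'I_4 -> 'rV[R]_2) (lambda : 'I_4 -> R)
    (i j k l : 'I_4) (a b c : R) : uniq [:: i; j; k; l] ->
  (forall m, 0 < lambda m) -> \sum_m lambda m *: u m = 0 ->
  u i = circle_point a -> u j = circle_point b -> u k = circle_point c ->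
  a <= b <= c -> c <= a + pi -> origin_in_triangle_off u j.
Proof.
move=> uq lam0 lam_u ui uj uk /andP[ab bc] ca.
have uqj := uniq_to_front2 uq.
apply/(origin_in_triangle_offP u uqj).
have := lam0 i; have := lam0 j; have := lam0 k; have := lam0 l.
move=> l0 k0 j0 i0.
move: lam_u; rewrite (sum_four _ uq) => lam_u.
have p0 : 0 <= sin (c - b) by apply: sin_ge0_pi; apply/andP; split; lra.
have q0 : 0 <= sin (b - a) by apply: sin_ge0_pi; apply/andP; split; lra.
have [ac|ac] := boolP (0 < c - a < pi).
  have s0 := sin_gt0_pi ac.
  exists (sin (c - a) * lambda i + lambda j * sin (c - b)).
  exists (sin (c - a) * lambda k + lambda j * sin (b - a)).
  exists (sin (c - a) * lambda l).
  split; first by split; rewrite ?addr_ge0 ?mulr_ge0// ltW.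
    by rewrite ltr_wpDl ?mulr_gt0// !addr_ge0 ?mulr_ge0// ltW.
  have arc := sin_arc a b c; rewrite -ui -uj -uk in arc.
  apply/rowP => m; move/(congr1 (fun z : 'rV_2 => z 0 m)): arc.
  move/(congr1 (fun z : 'rV_2 => z 0 m)): lam_u; rewrite !mxE => lam_u arc.
  rewrite -[RHS](mulr0 (sin (c - a))) -lam_u !mulrDr.
  by rewrite [_ * (lambda j * _)]mulrCA arc; ring.
have {ac}[ac|ac] : c = a \/ c = a + pi.
  move: ac; rewrite negb_and -!leNgt => /orP[]; [left|right]; lra.
  have uij : u j = u i by rewrite ui uj; congr circle_point; lra.
  exists (lambda i + lambda j), (lambda k), (lambda l).
  split; first by split; lra.
    lra.
  by rewrite scalerDl -lam_u uij.
have uki : u k = - u i.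
  by rewrite ui uk ac; apply/rowP => m; rewrite !mxE cosDpi sinDpi; case: ifP.
exists 1, 1, 0; split; [by split; lra | lra |].
by rewrite !scale1r scale0r addr0 uki subrr.
Qed.

(** One of the two arcs between [u i] and [u k] is at most a half turn: the one
    through [u j], or the one through [u l]. *)
Lemma opposite_triangles {R : realType} (u : 'I_4 -> 'rV[R]_2)
    (lambda : 'I_4 -> R) (i j k l : 'I_4) (a b c d : R) :
  uniq [:: i; j; k; l] ->
  (forall m, 0 < lambda m) -> \sum_m lambda m *: u m = 0 ->
  u i = circle_point a -> u j = circle_point b ->
  u k = circle_point c -> u l = circle_point d ->
  a <= b <= c -> c <= d <= a + pi *+ 2 ->
  origin_in_triangle_off u j \/ origin_in_triangle_off u l.
Proof.
move=> uq lam0 lam_u ui uj uk ul abc cda.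
have [ca|ca] := leP c (a + pi).
  by left; apply: (arc_le_pi u lambda i j k l a b c).
right; apply: (arc_le_pi u lambda k l i j c d (a + pi *+ 2)) => //.
- exact: uniq_rot2.
- by rewrite ui; apply/rowP => m; rewrite !mxE cosD2pi sinD2pi.
- rewrite mulr2n; lra.
Qed.

(** * Weights of the essential indices *)

(** Two dependent unit vectors are equal or antipodal.  If [u k = u l], either
    of them can stand for both in the triangle without [u i], which makes [l]
    removable.  If [u l = - u k], their total contribution to the relation is
    [(lambda k - lambda l) *: u k], and this can be written with a nonnegative
    weight on [u k] alone or on [u l] alone, so one of them is removable. *)
Lemma essential_independent {R : realType} (u : 'I_4 -> 'rV[R]_2)
    (lambda : 'I_4 -> R) (i j k l : 'I_4) :
  uniq [:: i; j; k; l] -> (forall m, unit_vector (u m)) ->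
  (forall m, 0 < lambda m) -> \sum_m lambda m *: u m = 0 ->
  origin_in_triangle_off u i ->
  ~ origin_in_triangle_off u k -> ~ origin_in_triangle_off u l ->
  forall x y, x *: u k + y *: u l = 0 -> x = 0 /\ y = 0.
Proof.
move=> uq u1 lam0 lam_u.
have uqk := uniq_to_front3 uq.
have uql := uniq_to_front4 uq.
move=> /(origin_in_triangle_offP u uq)[b [c [d [[b0 c0 d0] s0 /rV2P]]]].
move=> + /(origin_in_triangle_offP u uqk) nk /(origin_in_triangle_offP u uql) nl.
rewrite !mxE => -[e0 e1] x y /rV2P; rewrite !mxE => -[xy0 xy1].
have := u1 k; have := u1 l; rewrite /unit_vector => ul uk.
have i0 := lam0 i; have j0 := lam0 j; have k0 := lam0 k; have l0 := lam0 l.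
move: lam_u; rewrite (sum_four _ uq) => /rV2P; rewrite !mxE => -[f0 f1].
have /eqP : x ^+ 2 - y ^+ 2 = 0.
  have -> : x ^+ 2 - y ^+ 2 =
     (x * u k 0 0 - y * u l 0 0) * (x * u k 0 0 + y * u l 0 0)
   + (x * u k 0 1 - y * u l 0 1) * (x * u k 0 1 + y * u l 0 1)
   + x ^+ 2 * (1 - (u k 0 0 ^+ 2 + u k 0 1 ^+ 2))
   - y ^+ 2 * (1 - (u l 0 0 ^+ 2 + u l 0 1 ^+ 2)) by ring.
  by rewrite xy0 xy1 ul uk; ring.
rewrite subr_sqr mulf_eq0.
have [->|xn0] := eqVneq x 0.
  by rewrite sub0r add0r oppr_eq0 orbb => /eqP.
case/orP => /eqP yx; last first.
  have {}yx : y = - x by lra.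
  have gl0 : u l 0 0 = u k 0 0 by apply: (mulfI xn0); rewrite yx in xy0; lra.
  have gl1 : u l 0 1 = u k 0 1 by apply: (mulfI xn0); rewrite yx in xy1; lra.
  case: nl; exists 0, b, (c + d); split; [by split; lra | lra |].
  by apply/rV2P; rewrite !mxE; split; [rewrite -[RHS]e0 gl0|rewrite -[RHS]e1 gl1]; ring.
have {}yx : y = x by lra.
have gl0 : u l 0 0 = - u k 0 0.
  by apply: (mulfI xn0); rewrite yx in xy0; lra.
have gl1 : u l 0 1 = - u k 0 1.
  by apply: (mulfI xn0); rewrite yx in xy1; lra.
have [lk|kl] := leP (lambda l) (lambda k).
  case: nl; exists (lambda i), (lambda j), (lambda k - lambda l).
  split; [by split; lra | lra |].
  by apply/rV2P; rewrite !mxE; split; [rewrite -[RHS]f0 gl0|rewrite -[RHS]f1 gl1]; ring.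
case: nk; exists (lambda i), (lambda j), (lambda l - lambda k).
split; [by split; lra | lra |].
by apply/rV2P; rewrite !mxE; split; [rewrite -[RHS]f0 gl0|rewrite -[RHS]f1 gl1]; ring.
Qed.

(** Strict triangle inequality: [b] is the length of [c *: q + d *: r], and
    [b >= c + d] would force the scalar product of the unit
    vectors [q] and [r] to be at least 1, hence [q = r]. *)
Lemma weight_lt_sum {R : realType} (p q r : 'rV[R]_2) (b c d : R) :
  unit_vector p -> unit_vector q -> unit_vector r -> 0 < c -> 0 < d ->
  q <> r -> b *: p + c *: q + d *: r = 0 -> b < c + d.
Proof.
rewrite /unit_vector => p1 q1 r1 c0 d0 qr /rV2P; rewrite !mxE => -[e0 e1].
rewrite ltNge; apply/negP => cdb; apply: qr; apply/eqP; rewrite -subr_eq0.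
have b2 : b ^+ 2 = c ^+ 2 + d ^+ 2 + 2 * c * d * (q 0 0 * r 0 0 + q 0 1 * r 0 1).
  transitivity ((b * p 0 0) ^+ 2 + (b * p 0 1) ^+ 2).
    by rewrite !exprMn -mulrDr p1 mulr1.
  have -> : b * p 0 0 = - (c * q 0 0 + d * r 0 0) by lra.
  have -> : b * p 0 1 = - (c * q 0 1 + d * r 0 1) by lra.
  transitivity (c ^+ 2 * (q 0 0 ^+ 2 + q 0 1 ^+ 2)
    + d ^+ 2 * (r 0 0 ^+ 2 + r 0 1 ^+ 2)
    + 2 * c * d * (q 0 0 * r 0 0 + q 0 1 * r 0 1)); first by ring.
  by rewrite q1 r1 !mulr1.
have cd0 := mulr_gt0 c0 d0.
have g1 : 1 <= q 0 0 * r 0 0 + q 0 1 * r 0 1.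
  rewrite -(ler_pM2l cd0).
  have : 0 <= (b - (c + d)) * (b + (c + d)) by apply: mulr_ge0; lra.
  lra.
have : (q 0 0 - r 0 0) ^+ 2 + (q 0 1 - r 0 1) ^+ 2 = 0.
  apply/eqP; rewrite eq_le addr_ge0 ?sqr_ge0// andbT; lra.
move/eqP; rewrite paddr_eq0 ?sqr_ge0// !sqrf_eq0 => /andP[/eqP q0 /eqP q1'].
by apply/eqP/rV2P; rewrite !mxE.
Qed.

(** All three weights are positive: [b = 0] contradicts the independence of
    [u k] and [u l], while [c = 0] or [d = 0] would make [k] or [l] removable.
    Then the strict triangle inequality applies. *)
Lemma essential_weight_lt {R : realType} (u : 'I_4 -> 'rV[R]_2)
    (lambda : 'I_4 -> R) (i j k l : 'I_4) :
  uniq [:: i; j; k; l] -> (forall m, unit_vector (u m)) ->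
  (forall m, 0 < lambda m) -> \sum_m lambda m *: u m = 0 ->
  origin_in_triangle_off u i ->
  ~ origin_in_triangle_off u k -> ~ origin_in_triangle_off u l ->
  exists b c d : R,
    [/\ 0 < b, b < c + d & b *: u j + c *: u k + d *: u l = 0].
Proof.
move=> uq u1 lam0 lam_u oi nk nl.
have uqk := uniq_to_front3 uq.
have uql := uniq_to_front4 uq.
have indep := essential_independent u lambda i j k l uq u1 lam0 lam_u oi nk nl.
have ukl : u k <> u l.
  move=> kl; have [] := indep 1 (-1); first by rewrite kl scaleN1r scale1r subrr.
  by move/eqP; rewrite oner_eq0.
move/(origin_in_triangle_offP u uq): oi => [b [c [d [[b0 c0 d0] s0 e]]]].
move/(origin_in_triangle_offP u uqk): nk => nk.
move/(origin_in_triangle_offP u uql): nl => nl.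
have b_gt0 : 0 < b.
  rewrite lt_neqAle b0 andbT; apply/eqP => bE; move: e.
  rewrite -bE scale0r add0r => /indep[c_0 d_0].
  by move: s0; rewrite -bE c_0 d_0 !addr0 ltxx.
have c_gt0 : 0 < c.
  rewrite lt_neqAle c0 andbT; apply/eqP => cE; case: nk; exists 0, b, d.
  split=> //; first by move: s0; rewrite -cE addr0 add0r.
  by rewrite -e -cE !scale0r add0r addr0.
have d_gt0 : 0 < d.
  rewrite lt_neqAle d0 andbT; apply/eqP => dE; case: nl; exists 0, b, c.
  split=> //; first by move: s0; rewrite -dE addr0 add0r.
  by rewrite -e -dE !scale0r add0r addr0.
exists b, c, d; split=> //.
exact: weight_lt_sum (u1 j) (u1 k) (u1 l) c_gt0 d_gt0 ukl e.
Qed.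

(** Eliminating [u i] and [u j] from the relation between the four vectors
    leaves one between [u k] and [u l], whose coefficients must be zero. *)
Lemma essential_pair_heavier {R : realType} (u : 'I_4 -> 'rV[R]_2)
    (lambda : 'I_4 -> R) (i j k l : 'I_4) :
  uniq [:: i; j; k; l] -> (forall m, unit_vector (u m)) ->
  (forall m, 0 < lambda m) -> \sum_m lambda m *: u m = 0 ->
  origin_in_triangle_off u i -> origin_in_triangle_off u j ->
  ~ origin_in_triangle_off u k -> ~ origin_in_triangle_off u l ->
  lambda i + lambda j < lambda k + lambda l.
Proof.
move=> uq u1 lam0 lam_u oi oj nk nl.
have uqj := uniq_to_front2 uq.
have indep := essential_independent u lambda i j k l uq u1 lam0 lam_u oi nk nl.
have [b [c [d [b0 lt1 /rV2P]]]] :=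
  essential_weight_lt u lambda i j k l uq u1 lam0 lam_u oi nk nl.
have [b' [c' [d' [b0' lt2 /rV2P]]]] :=
  essential_weight_lt u lambda j i k l uqj u1 lam0 lam_u oj nk nl.
move: lam_u; rewrite (sum_four _ uq) => /rV2P.
rewrite !mxE => -[f0 f1] [g0 g1] [h0 h1].
have bb0 := mulr_gt0 b0 b0'.
have [] := indep (b * b' * lambda k - lambda i * b * c' - lambda j * b' * c)
                 (b * b' * lambda l - lambda i * b * d' - lambda j * b' * d).
  apply/rV2P; rewrite !mxE; split.
    transitivity (b * b' * (lambda i * u i 0 0 + lambda j * u j 0 0
      + lambda k * u k 0 0 + lambda l * u l 0 0)
      - lambda i * b * (b' * u i 0 0 + c' * u k 0 0 + d' * u l 0 0)
      - lambda j * b' * (b * u j 0 0 + c * u k 0 0 + d * u l 0 0)); first by ring.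
    by rewrite f0 g0 h0; ring.
  transitivity (b * b' * (lambda i * u i 0 1 + lambda j * u j 0 1
      + lambda k * u k 0 1 + lambda l * u l 0 1)
      - lambda i * b * (b' * u i 0 1 + c' * u k 0 1 + d' * u l 0 1)
      - lambda j * b' * (b * u j 0 1 + c * u k 0 1 + d * u l 0 1)); first by ring.
  by rewrite f1 g1 h1; ring.
move=> ek el; rewrite -(ltr_pM2l bb0).
have := mulr_gt0 (mulr_gt0 (lam0 i) b0) (_ : 0 < c' + d' - b').
have := mulr_gt0 (mulr_gt0 (lam0 j) b0') (_ : 0 < c + d - b).
rewrite !subr_gt0 => /(_ lt1) p1 /(_ lt2) p2; lra.
Qed.

(** * The common triangle *)

Lemma common_triangle {R : realType} (v w : 'I_4 -> 'rV[R]_2)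
    (lambda : 'I_4 -> R) (i j k l : 'I_4) :
  uniq [:: i; j; k; l] ->
  (forall m, unit_vector (v m)) -> (forall m, unit_vector (w m)) ->
  (forall m, 0 < lambda m) ->
  \sum_m lambda m *: v m = 0 -> \sum_m lambda m *: w m = 0 ->
  origin_in_triangle_off v i -> origin_in_triangle_off v j ->
  origin_in_triangle_off w i \/ origin_in_triangle_off w k ->
  origin_in_triangle_off w j \/ origin_in_triangle_off w l ->
  exists m, origin_in_triangle_off v m /\ origin_in_triangle_off w m.
Proof.
move=> uq v1 w1 lam0 lam_v lam_w vi vj wik wjl; apply: contrapT => none.
have none' m : origin_in_triangle_off v m -> origin_in_triangle_off w m -> False.
  by move=> vm wm; apply: none; exists m.
case: wik => [/(none' _ vi)//|wk]; case: wjl => [/(none' _ vj)//|wl].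
have uqr := uniq_rot2 uq.
have := essential_pair_heavier v lambda i j k l uq v1 lam0 lam_v vi vj
  (none' k ^~ wk) (none' l ^~ wl).
have := essential_pair_heavier w lambda k l i j uqr w1 lam0 lam_w wk wl
  (none' i vi) (none' j vj).
by move=> /lt_trans/[apply]; rewrite ltxx.
Qed.

Theorem lemma1p9 (R : realType) (v w : 'I_4 -> 'rV[R]_2) (lambda : 'I_4 -> R)
    (v_unit : forall i, unit_vector (v i))
    (w_unit : forall i, unit_vector (w i))
    (lambda01 : forall i, 0 < lambda i < 1)
    (v_order : clockwise_order v)
    (w_order : counterclockwise_order w)
    (lambda_sum : \sum_(i < 4) lambda i = 1)
    (v_sum : \sum_(i < 4) lambda i *: v i = 0)
    (w_sum : \sum_(i < 4) lambda i *: w i = 0) :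
  exists A : {set 'I_4},
    [/\ #|A| = 3%N,
        closed_convex_hull [set v i | i in [set` A]] 0
      & closed_convex_hull [set w i | i in [set` A]] 0].
Proof.
have lam0 i : 0 < lambda i by case/andP: (lambda01 i).
suff [m [vm wm]] : exists m, origin_in_triangle_off v m /\ origin_in_triangle_off w m.
  exists [set~ m]%SET; split; [by rewrite cardsC1 card_ord| |]; exact: origin_in_hull.
pose i0 : 'I_4 := ord0; pose i3 : 'I_4 := ord_max.
pose i1 : 'I_4 := @Ordinal 4 1 isT; pose i2 : 'I_4 := @Ordinal 4 2 isT.
case: v_order => s [vs s_le s_turn]; case: w_order => t [wt t_le t_turn].
have s01 := s_le i0 i1 isT; have s12 := s_le i1 i2 isT; have s23 := s_le i2 i3 isT.
have t01 := t_le i0 i1 isT; have t12 := t_le i1 i2 isT; have t23 := t_le i2 i3 isT.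
rewrite -/i0 -/i3 in s_turn t_turn.
have turn (u : 'I_4 -> 'rV[R]_2) m x :
    u m = circle_point x -> u m = circle_point (x + pi *+ 2).
  by move->; apply/rowP => n; rewrite !mxE cosD2pi sinD2pi.
(* For [v] the angles increase from index 3 to index 0. *)
have v20 : origin_in_triangle_off v i2 \/ origin_in_triangle_off v i0.
  by apply: (opposite_triangles v lambda i3 i2 i1 i0
    (s i3) (s i2) (s i1) (s i0)) => //; apply/andP; split; lra.
have v13 : origin_in_triangle_off v i1 \/ origin_in_triangle_off v i3.
  apply: (opposite_triangles v lambda i2 i1 i0 i3
    (s i2) (s i1) (s i0) (s i3 + pi *+ 2)) => //; first exact: turn.
    by apply/andP.
  by rewrite lerD2r s23 andbT; lra.
have w13 : origin_in_triangle_off w i1 \/ origin_in_triangle_off w i3.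
  by apply: (opposite_triangles w lambda i0 i1 i2 i3
    (t i0) (t i1) (t i2) (t i3)) => //; apply/andP.
have w20 : origin_in_triangle_off w i2 \/ origin_in_triangle_off w i0.
  apply: (opposite_triangles w lambda i1 i2 i3 i0
    (t i1) (t i2) (t i3) (t i0 + pi *+ 2)) => //; first exact: turn.
    by apply/andP.
  by rewrite lerD2r t01 andbT.
case: v13 => [v1|v3]; case: v20 => [v2|v0].
- by apply: (common_triangle v w lambda i1 i2 i3 i0).
- by apply: (common_triangle v w lambda i1 i0 i3 i2) => //; apply/or_comm.
- by apply: (common_triangle v w lambda i3 i2 i1 i0) => //; apply/or_comm.
- by apply: (common_triangle v w lambda i3 i0 i1 i2) => //; apply/or_comm.
Qed.
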